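(* Let $N$ be a network and $\phi\in\Phi(N)$. If $\phi$ is not derivable in the Logic of Secrets for $N$ (i.e. $\nvdash_N\phi$), then there is a finite protocol ${\cal P}$ over $N$ such that ${\cal P}\nvDash\phi$.
   Context: A network $N$ is a finite undirected graph (loops and multiple edges allowed) whose vertices are parties and whose edges, called channels, are labeled by secret variables (each channel may carry finitely many labels, each label used on only one channel); $Ch(N)$ is the set of channels. A semi-protocol over $N$ assigns to each channel $c$ a set $V(c)$ of values and to each party $p$ a predicate $L_p$ on the values of the channels incident with $p$; a run is a function $r$ with $r(c)\in V(c)$ for all $c$ satisfying all $L_p$; a protocol is a semi-protocol with at least one run; it is finite if every $V(c)$ is finite. $A$ functionally determines $B$ w.r.t. ${\cal P}$ if any two runs agreeing on all channels of $A$ agree on all channels of $B$. $\Phi(N)$ is the smallest set of formulas containing $A\rhd B$ for finite sets of channels $A,B$, the constant $\bot$, and closed under $\to$. Semantics: ${\cal P}\nvDash\bot$; ${\cal P}\vDash A\rhd B$ iff $A$ functionally determines $B$ w.r.t. ${\cal P}$; ${\cal P}\vDash\phi_1\to\phi_2$ iff ${\cal P}\nvDash\phi_1$ or ${\cal P}\vDash\phi_2$. A path is a sequence of channels forming an undirected walk; $G$ is a gateway between $A$ and $B$ if every path starting in $A$ and ending in $B$ contains a channel of $G$. The Logic of Secrets for $N$: all propositional tautologies, Modus Ponens, and axioms Reflexivity ($A\rhd B$ if $A\supseteq B$), Augmentation ($A\rhd B\to A\cup C\rhd B\cup C$), Transitivity ($A\rhd B\to(B\rhd C\to A\rhd C)$),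 Gateway ($A\rhd B\to G\rhd B$ if $G$ is a gateway between $A$ and $B$ in $N$). $\vdash_N\phi$ means $\phi$ is derivable. *)

(* Defs.v *)
From mathcomp Require Import all_boot.

Set Implicit Arguments.
Unset Strict Implicit.
Unset Printing Implicit Defensive.

(** A channel is given by its set of one (loop) or two endpoints; distinct
    channels may have the same endpoints.  Labels are names of channels: each
    label is used on exactly one channel, and formulas refer to channels only. *)
Record network := Network {
  party : finType;
  channel : finType;
  ends : channel -> {set party};
  ends_card : forall c, 0 < #|ends c| <= 2;
  secret : finType;
  secret_channel : secret -> channel
}.

Section Syntax.

Variable N : network.

Inductive formula : Type :=
| Bot
| Det of {set channel N} & {set channel N}
| Imp of formula & formula.

(** For [u = v] this says that [c] is a loop at [u]. *)
Definition joins (c : channel N) (u v : party N) : Prop := ends c = [set u; v].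

Fixpoint walk (u : party N) (s : seq (channel N)) (v : party N) : Prop :=
  if s is c :: s' then exists w, joins c u w /\ walk w s' v else u = v.

Definition is_path (s : seq (channel N)) : Prop := exists u v, walk u s v.

(** Paths from a set of channels to another one are nonempty; a single channel
    of [A :&: B] is such a path. *)
Definition gateway (G A B : {set channel N}) : Prop :=
  forall (c : channel N) (s : seq (channel N)),
    is_path (c :: s) -> c \in A -> last c s \in B ->
    exists2 g, g \in c :: s & g \in G.

Fixpoint eval (v : {set channel N} -> {set channel N} -> bool) (phi : formula)
    : bool :=
  match phi with
  | Bot => false
  | Det A B => v A B
  | Imp phi1 phi2 => eval v phi1 ==> eval v phi2
  end.

Definition tautology (phi : formula) : Prop := forall v, eval v phi.

Inductive derivable : formula -> Prop :=
| d_taut phi : tautology phi -> derivable phi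
| d_mp phi psi : derivable (Imp phi psi) -> derivable phi -> derivable psi
| d_reflexivity (A B : {set channel N}) : B \subset A -> derivable (Det A B)
| d_augmentation A B C :
    derivable (Imp (Det A B) (Det (A :|: C) (B :|: C)))
| d_transitivity A B C :
    derivable (Imp (Det A B) (Imp (Det B C) (Det A C)))
| d_gateway A B G :
    gateway G A B -> derivable (Imp (Det A B) (Det G B)).

End Syntax.

Arguments Bot {N}.

Section Semantics.

Variable N : network.

(** The local condition of [p] only sees the values of the channels incident
    with [p]. *)
Record semi_protocol := SemiProtocol {
  value : channel N -> Type;
  local : forall p : party N,
    (forall c : {c : channel N | p \in ends c}, value (val c)) -> Prop
}.

Definition is_run (S : semi_protocol) (r : forall c, value S c) : Prop :=
  forall p : party N, @local S p (fun c => r (val c)).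

Record protocol := Protocol {
  semi :> semi_protocol;
  has_run : exists r, @is_run semi r
}.

Definition finite_protocol (P : protocol) : Prop :=
  forall c, exists (n : nat) (f : 'I_n -> value P c), bijective f.

Definition determines (P : protocol) (A B : {set channel N}) : Prop :=
  forall r1 r2 : (forall c, value P c), is_run r1 -> is_run r2 ->
    (forall c, c \in A -> r1 c = r2 c) -> forall c, c \in B -> r1 c = r2 c.

Fixpoint sat (P : protocol) (phi : formula N) : Prop :=
  match phi with
  | Bot => False
  | Det A B => determines P A B
  | Imp phi1 phi2 => ~ sat P phi1 \/ sat P phi2
  end.

End Semantics.

(* Main.v *)
Require Import Defs.
From mathcomp Require Import all_boot.
From Stdlib Require Import Classical.
From Stdlib Require List.

Set Implicit Arguments.
Unset Strict Implicit.
Unset Printing Implicit Defensive.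

(** There are finitely many valuations of the atoms [A |> B], so an underivable
    formula is refuted by a valuation [v] under which every theorem is true.
    Call [A*] the set of channels [c] with [v A {c}].  For each set [A], let a
    run carry one bit per channel, which is [false] on the channels of [A*], and
    which must be the same for all channels outside [A*] that meet at a party.
    Flipping all bits outside [A*] shows that [A] determines no more than [A*].
    Conversely, if [v C D], two runs that agree on [C] cannot differ at [d] in
    [D]: as bits propagate along the paths that avoid [A*], the set [A*] would
    be a gateway between [C] and [d], which puts [d] in [A*], where all runs agree.
    The product over all [A] of these protocols satisfies exactly the formulas
    that are true under [v]. *)

Section CountermodelValuation.

Variable N : network.

Definition model (v : {set channel N} -> {set channel N} -> bool) : Prop :=
  forall psi, derivable psi -> eval v psi.

Lemma eval_ext (v v' : {set channel N} -> {set channel N} -> bool) phi :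
  v =2 v' -> eval v phi = eval v' phi.
Proof. by move=> vv'; elim: phi => //= phi1 -> phi2 ->. Qed.

Lemma eval_foldr_Imp v (l : seq (formula N)) phi :
  eval v (foldr (@Imp N) phi l) = all (eval v) l ==> eval v phi.
Proof. by elim: l => //= psi l ->; case: eval. Qed.

Lemma derivable_foldr_Imp (l : seq (formula N)) phi :
  List.Forall (@derivable N) l -> derivable (foldr (@Imp N) phi l) ->
  derivable phi.
Proof. by elim=> //= psi l' d_psi _ IHl d_imp; apply/IHl/(d_mp d_imp). Qed.

(** Otherwise each of the finitely many valuations satisfies [phi] or falsifies some theorem. With
    these theorems as premises, [phi] becomes the conclusion of a tautology. *)
Lemma countermodel (phi : formula N) :
  ~ derivable phi -> exists2 v, model v & ~~ eval v phi.
Proof.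
move=> not_phi; apply: NNPP => no_model; apply: not_phi.
pose val_of (w : {ffun {set channel N} * {set channel N} -> bool}) A B :=
  w (A, B).
have [l l_thm l_phi] : exists2 l, List.Forall (@derivable N) l &
    forall w, w \in enum {ffun {set channel N} * {set channel N} -> bool} ->
      eval (val_of w) (foldr (@Imp N) phi l).
  elim: (enum _) => [|w ws [l l_thm l_phi]]; first by exists [::].
  have [w_phi|w_phi] := boolP (eval (val_of w) phi).
    exists l => // w'; rewrite inE => /orP[/eqP->|/l_phi//].
    by rewrite eval_foldr_Imp w_phi implybT.
  have [psi d_psi w_psi] : exists2 psi, derivable psi & ~~ eval (val_of w) psi.
    apply: NNPP => no_psi; apply: no_model; exists (val_of w) => // psi d_psi.
    by apply/negPn/negP => w_psi; apply: no_psi; exists psi.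
  exists (psi :: l) => [|w' /=]; first by constructor.
  rewrite inE => /orP[/eqP->|/l_phi->]; first by rewrite (negbTE w_psi).
  exact: implybT.
apply: derivable_foldr_Imp l_thm _; apply: d_taut => v.
rewrite (@eval_ext _ (val_of [ffun AB => v AB.1 AB.2])) ?l_phi ?mem_enum //.
by move=> A B; rewrite /val_of ffunE.
Qed.

End CountermodelValuation.

Section Closure.

Variables (N : network) (v : {set channel N} -> {set channel N} -> bool).
Hypothesis v_model : model v.

Implicit Types A B C D G : {set channel N}.

Definition cl A : {set channel N} := [set c | v A [set c]].

Lemma model_refl A B : B \subset A -> v A B.
Proof. by move=> sBA; have := v_model (d_reflexivity sBA). Qed.

Lemma model_trans B A C : v A B -> v B C -> v A C.
Proof. by have /= := v_model (d_transitivity A B C); do 2!case: (v _ _). Qed.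

Lemma model_gateway A B G : gateway G A B -> v A B -> v G B.
Proof. by move=> gG; have /implyP := v_model (d_gateway gG). Qed.

(** Augmenting the first fact by [A] and the second by [B] makes [B :|: A] a link between [A] and
    [B :|: C]. *)
Lemma model_setU A B C : v A B -> v A C -> v A (B :|: C).
Proof.
move=> vB vC; apply: (@model_trans (B :|: A)).
  have /implyP/(_ vB) /= := v_model (d_augmentation A B A).
  by rewrite setUid.
have /implyP/(_ vC) /= := v_model (d_augmentation A C B).
by rewrite setUC [C :|: B]setUC.
Qed.

Lemma sub_cl A B : (B \subset cl A) = v A B.
Proof.
apply/subsetP/idP => [sB | vB c cB]; last first.
  by rewrite inE; apply: model_trans vB _; apply: model_refl; rewrite sub1set.
have -> : B = \bigcup_(c in B) [set c].
  apply/setP => c; apply/idP/bigcupP => [cB | [c' c'B]].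
    by exists c; rewrite ?set11.
  by rewrite inE => /eqP->.
apply: (big_ind (v A)) => [|B1 B2|c /sB]; last by rewrite inE.
- by apply: model_refl; apply: sub0set.
- exact: model_setU.
Qed.

(** The gateway axiom lets [cl A] determine [d], and [A] determines all of [cl A]. *)
Lemma cl_gateway A C d : v C [set d] -> gateway (cl A) C [set d] -> d \in cl A.
Proof.
move=> vCd gA; rewrite inE; apply: model_trans (model_gateway gA vCd).
by rewrite -sub_cl.
Qed.

End Closure.

Lemma eq_along_walk (N : network) (T : Type) (S : {set channel N})
    (f : channel N -> T) u c s w :
  (forall p c1 c2, p \in ends c1 -> p \in ends c2 ->
     c1 \notin S -> c2 \notin S -> f c1 = f c2) ->
  walk u (c :: s) w -> {in c :: s, forall c', c' \notin S} ->
  f c = f (last c s).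
Proof.
move=> f_const; elim: s u c => //= c' s IHs u c [p [c_p [q [c'_q walk_s]]]] nS.
(* The party [p] is shared by [c] and [c'], so [f_const] applies there. *)
rewrite -(IHs p) => [||c0 c0s]; last by apply: nS; rewrite inE c0s orbT.
  by apply: (f_const p); rewrite ?c_p ?c'_q ?nS ?inE ?eqxx ?orbT.
by exists q.
Qed.

Section CanonicalProtocol.

Variables (N : network) (v : {set channel N} -> {set channel N} -> bool).
Hypothesis v_model : model v.

(* The bit with index [A] is the value of the channel in the [A]-th factor. *)
Definition canonical_semi : semi_protocol N :=
  @SemiProtocol N (fun=> {ffun {set channel N} -> bool})
    (fun p r => forall A c1 c2,
      (val c1 \in cl v A -> r c1 A = false) /\
      (val c1 \notin cl v A -> val c2 \notin cl v A -> r c1 A = r c2 A)).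

Lemma canonical_runP (r : channel N -> {ffun {set channel N} -> bool}) :
  @is_run N canonical_semi r -> forall A p c1 c2,
  p \in ends c1 -> p \in ends c2 ->
  (c1 \in cl v A -> r c1 A = false) /\
  (c1 \notin cl v A -> c2 \notin cl v A -> r c1 A = r c2 A).
Proof.
move=> run_r A p c1 c2 pc1 pc2.
exact: (run_r p A (Sub c1 pc1) (Sub c2 pc2)).
Qed.

(** Differs from the zero run only in factor [C], and there exactly outside [cl v C]. *)
Definition flip_run C (c : channel N) : {ffun {set channel N} -> bool} :=
  [ffun A => (A == C) && (c \notin cl v A)].

Lemma flip_run_is_run C : @is_run N canonical_semi (flip_run C).
Proof.
move=> p A c1 c2; rewrite !ffunE.
by split=> [-> | -> ->]; rewrite ?andbF.
Qed.

Lemma zero_run_is_run : @is_run N canonical_semi (fun=> [ffun=> false]).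
Proof. by move=> p A c1 c2; rewrite !ffunE. Qed.

Definition canonical_protocol : protocol N :=
  Protocol (ex_intro (@is_run N canonical_semi) _ zero_run_is_run).

Lemma canonical_finite : finite_protocol canonical_protocol.
Proof.
move=> c; exists #|{: {ffun {set channel N} -> bool}}|, enum_val.
exact: enum_val_bij.
Qed.

Lemma canonical_determines C D : determines canonical_protocol C D <-> v C D.
Proof.
split=> [CD | vCD r1 r2 run1 run2 eqC d dD].
  rewrite -(sub_cl v_model); apply/subsetP=> d dD; apply/negPn/negP=> d_ncl.
  (* The two runs agree on [C], since [C] lies in [cl v C], but differ at [d]. *)
  have /ffunP/(_ C) : [ffun=> false] = flip_run C d.
    apply: CD dD => [||c cC].
    - exact: zero_run_is_run.
    - exact: flip_run_is_run.
    apply/ffunP => A; rewrite !ffunE; case: eqP => //= ->.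
    suff -> : c \in cl v C by [].
    by apply: subsetP cC; rewrite (sub_cl v_model) model_refl.
  by rewrite !ffunE eqxx d_ncl.
apply/ffunP => A.
have r_false r : @is_run N canonical_semi r -> d \in cl v A -> r d A = false.
  (* Some party must be incident with [d] to enforce the zero bit. *)
  move=> run_r; have /andP[/card_gt0P[p pd] _] := ends_card d.
  exact: (proj1 (canonical_runP run_r A pd pd)).
have [d_cl|d_ncl] := boolP (d \in cl v A); first by rewrite !r_false.
apply/eqP; apply: contraR d_ncl => /eqP r12d.
apply: (@cl_gateway _ _ v_model A C).
  by apply: (model_trans v_model vCD); apply: model_refl; rewrite ?sub1set.
move=> c s [u [w walk_cs]] cC; rewrite inE => /eqP last_d.
(* A path avoiding [cl v A] carries one bit from [c] to [d] in each run, and the runs agree at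
   [c]. *)
apply: NNPP => no_g; case: r12d.
have r_const r : @is_run N canonical_semi r -> r c A = r d A.
  move=> run_r; rewrite -last_d.
  apply: (@eq_along_walk N bool (cl v A) (fun c => r c A) u c s w) => //.
    move=> p c1 c2 pc1 pc2.
    exact: (proj2 (canonical_runP run_r A pc1 pc2)).
  by move=> c' c's; apply/negP => c'A; apply: no_g; exists c'.
by rewrite -(r_const r1) // -(r_const r2) // eqC.
Qed.

Lemma canonical_sat phi : sat canonical_protocol phi <-> eval v phi.
Proof.
elim: phi => //= [A B|phi1 IH1 phi2 IH2]; first exact: canonical_determines.
rewrite IH1 IH2 implybE.
split=> [[/negP->|->] | /orP[/negP|]].
- by [].
- exact: orbT.
- by left.
- by right.
Qed.

End CanonicalProtocol.

Theorem theorem9 (N : network) (phi : formula N) (hphi : ~ derivable phi) :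
  exists P : protocol N, finite_protocol P /\ ~ sat P phi.
Proof.
have [v v_model v_phi] := countermodel hphi.
exists (canonical_protocol v); split; first exact: canonical_finite.
by move/(canonical_sat v_model); apply/negP.
Qed.
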